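(* Let $m\ge 1$, let $i,j\in\{0,\dots,2^m-1\}$ with $i\ne j$, and let $a\in\mathbb{C}$. Then $R_{i\times(a)+j}^{-1}=R_{i\times(-a)+j}$, i.e. $R_{i\times(-a)+j}R_{i\times(a)+j}=R_{i\times(a)+j}R_{i\times(-a)+j}=I$.
   Context: Rows and columns of $2^m\times 2^m$ complex matrices are indexed from $0$ to $2^m-1$. For $a\in\mathbb{C}$ and $i\neq j$, $R_{i\times(a)+j}$ is the $2^m\times 2^m$ row-addition elementary matrix (adding $a$ times row $i$ to row $j$ under left multiplication): it has $1$ in every diagonal position, $a$ in row $j$, column $i$, and $0$ elsewhere. $I$ is the $2^m\times 2^m$ identity matrix. *)

(* Defs.v *)
From HB Require Import structures.
From mathcomp Require Import all_boot all_order all_algebra.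

Set Implicit Arguments.
Unset Strict Implicit.
Unset Printing Implicit Defensive.

Import GRing.Theory.
Local Open Scope ring_scope.

(* The elementary matrix R_{i x (a) + j}: left multiplication by it adds
   a times row i to row j, so a sits in row j, column i. *)
Definition rowadd_mx (C : pzRingType) (n : nat) (i : 'I_n) (a : C) (j : 'I_n)
    : 'M[C]_n :=
  \matrix_(k, l) if k == l then 1 else if (k == j) && (l == i) then a else 0.

(* Main.v *)
Require Import Defs.
From HB Require Import structures.
From mathcomp Require Import all_boot all_order all_algebra.
From mathcomp Require Import reals.
From mathcomp Require Import complex.

Set Implicit Arguments.
Unset Strict Implicit.
Unset Printing Implicit Defensive.

Import GRing.Theory.
Local Open Scope ring_scope.

(* As E_{j,i}^2 = 0 for i <> j, the product (1 + a E_{j,i}) (1 + b E_{j,i}) is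
   1 + (a + b) E_{j,i}; so a |-> R_{i x (a) + j} turns sums into products. *)

(** By [mul_rowadd_mx], parameters add under multiplication; taking [a] and [- a], in either order,
    gives parameter 0, which is the identity by [rowadd_mx0]. *)

Lemma rowadd_mxE (C : pzRingType) (n : nat) (i j : 'I_n) (a : C) :
  i != j -> rowadd_mx i a j = 1%:M + a *: delta_mx j i.
Proof.
move=> nij; apply/matrixP=> k l; rewrite !mxE.
case: (eqVneq k l) => [<-|_]; last by case: ifP; rewrite ?mulr1 ?mulr0 add0r.
(* On the diagonal the [delta_mx] term vanishes: [k] cannot equal both [j] and [i]. *)
case: (eqVneq k j) => [->|_]; last by rewrite mulr0 addr0.
by rewrite eq_sym (negPf nij) mulr0 addr0.
Qed.

Lemma mul_rowadd_mx (C : comPzRingType) (n : nat) (i j : 'I_n) (a b : C) :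
  i != j -> rowadd_mx i a j *m rowadd_mx i b j = rowadd_mx i (a + b) j.
Proof.
move=> nij; rewrite !rowadd_mxE // mulmxDl mul1mx mulmxDr mulmx1.
(* Pulling [b] out of the right factor uses commutativity of [C]. *)
rewrite -scalemxAl -scalemxAr mul_delta_mx_0 // !scaler0 addr0.
by rewrite -addrA -scalerDl [b + a]addrC.
Qed.

Lemma rowadd_mx0 (C : pzRingType) (n : nat) (i j : 'I_n) :
  i != j -> rowadd_mx i (0 : C) j = 1%:M.
Proof. by move=> nij; rewrite rowadd_mxE // scale0r addr0. Qed.

Theorem proposition4p2 (R : realType) (m : nat) (hm : (1 <= m)%N)
    (i j : 'I_(2 ^ m)%N) (hij : i != j) (a : R[i]) :
  [/\ rowadd_mx i a j \in unitmx,
      invmx (rowadd_mx i a j) = rowadd_mx i (- a) j,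
      rowadd_mx i (- a) j *m rowadd_mx i a j = 1%:M
    & rowadd_mx i a j *m rowadd_mx i (- a) j = 1%:M].
Proof.
have mulNa : rowadd_mx i (- a) j *m rowadd_mx i a j = 1%:M.
  by rewrite mul_rowadd_mx // addNr rowadd_mx0.
have mulaN : rowadd_mx i a j *m rowadd_mx i (- a) j = 1%:M.
  by rewrite mul_rowadd_mx // subrr rowadd_mx0.
have [unit_a _] := mulmx1_unit mulaN.
(* With A the matrix for [a] and B that for [- a], B is A^-1 (A B) = A^-1. *)
by split=> //; rewrite -[RHS](mulKmx unit_a) mulaN mulmx1.
Qed.
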